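(* Let $w$ be a formal parameter, and let $A$ and $B$ be the tree-expanded series with coefficients in $\mathbb{C}[w]$ defined inductively by $$A = Y + w\, A/Y + Y\backslash A + w\, A/Y\backslash A,$$ $$B = Y - w\, Y/B - B\backslash Y - w\, Y/B\backslash Y.$$ Then, in the group $G^{\mathrm{dif}}$ of tree-expanded formal diffeomorphisms, $A\circ B = Y$, that is, $A$ is the inverse of $B$. This identity can be specialized to any complex value of $w$.
   Context: Trees: a planar binary rooted tree has a number of internal vertices called its order; $Y_n$ is the set of planar binary rooted trees with $n$ internal vertices. The tree with no internal vertex is denoted $|$ (root tree), and the tree with one internal vertex is denoted $Y$ (vertex tree). For trees $s,t$, $s\vee t$ is the tree obtained by grafting $s$ (left) and $t$ (right) on a new root vertex; every tree $t\neq |$ is uniquely of the form $t=t_l\vee t_r$. Over and under products: for trees $s,t\neq |$, $s/t$ (''$s$ over $t$'') is the tree obtained by grafting the root of $s$ on the left-most leaf of $t$, and $s\backslash t$ (''$s$ under $t$'') is the tree obtained by grafting the root of $t$ on the right-most leaf of $s$. Both are associative and satisfy $(a/b)\backslash c=a/(b\backslash c)$ for trees $a,b,c\neq |$, so an expression $a/b\backslash c$ is unambiguous. Both are extended bilinearly to formal series of trees of order at least $1$. Tree-expanded series: for a commutative unital associative algebra $R$, $G^{\mathrm{dif}}$ is the set of formal series $S=\sum_{n\ge1}\sum_{t\in Y_n} S_t\, t$ with $S_t\in R$ and $S_Y=1$. Composition is $S\circ T=\sum_{n\geq 1}\sum_{t\in Y_n} S_t\, T^t$, where $T^t$ is obtained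 by inserting $T$ at every internal vertex of $t$, i.e. recursively $T^{Y}=T$ and, for $t=t_l\vee t_r$, $T^t=T^{t_l}/T\backslash T^{t_r}$, where the factor $T^{t_l}/$ (respectively $\backslash T^{t_r}$) is omitted if $t_l=|$ (respectively $t_r=|$). With this operation $G^{\mathrm{dif}}$ is a group with unit the series $Y$. *)

(* Defs.v *)
From HB Require Import structures.
From mathcomp Require Import all_boot all_order all_algebra.
From mathcomp Require Import reals.
From mathcomp Require Export complex.
From mathcomp Require Import zify.

Set Implicit Arguments.
Unset Strict Implicit.
Unset Printing Implicit Defensive.

Import GRing.Theory.
Local Open Scope ring_scope.

(* Planar binary rooted trees: [Node s t] is the grafting of s (left) and t
   (right) on a new root vertex. *)
Inductive tree := Leaf | Node of tree & tree.

Fixpoint tree_eq (s t : tree) : bool :=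
  match s, t with
  | Leaf, Leaf => true
  | Node s1 s2, Node t1 t2 => tree_eq s1 t1 && tree_eq s2 t2
  | _, _ => false
  end.

Lemma tree_eqP : Equality.axiom tree_eq.
Proof.
elim=> [|s1 IH1 s2 IH2] [|t1 t2] /=; try by constructor.
by apply: (iffP andP) => [[/IH1 -> /IH2 ->]|[/IH1 ? /IH2 ?]].
Qed.

HB.instance Definition _ := hasDecEq.Build tree tree_eqP.

Fixpoint order (t : tree) : nat :=
  if t is Node l r then (order l + order r).+1 else 0%N.

(* The root of s is grafted on the left-most leaf of t. *)
Fixpoint over (s t : tree) : tree :=
  if t is Node l r then Node (over s l) r else s.

(* The root of t is grafted on the right-most leaf of s. *)
Fixpoint under (s t : tree) : tree :=
  if s is Node l r then Node l (under r t) else t.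

(* Trees of order at least 1, the index set of the series. *)
Record ptree := PTree { ptree_val :> tree; _ : ptree_val != Leaf }.
HB.instance Definition _ := [isSub for ptree_val].
HB.instance Definition _ := [Equality of ptree by <:].

Definition vertex : ptree := @PTree (Node Leaf Leaf) isT.

(* All trees of height at most h; they include all trees of order at most h. *)
Fixpoint trees_height (h : nat) : seq tree :=
  if h is h'.+1 then
    Leaf :: [seq Node l r | l <- trees_height h', r <- trees_height h']
  else [:: Leaf].

(* Each tree of order between 1 and n, once (mem_ptrees, uniq_ptrees). *)
Definition ptrees (n : nat) : seq ptree :=
  pmap insub [seq t <- trees_height n | (order t <= n)%N].

Lemma mem_trees_height h t : (order t <= h)%N -> t \in trees_height h.
Proof.
elim: h t => [|h IH] [|l r] //= le_lr; rewrite inE /=.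
by apply/allpairsP; exists (l, r); split=> //=; apply: IH; lia.
Qed.

Lemma uniq_trees_height h : uniq (trees_height h).
Proof.
elim: h => [//|h IH] /=; apply/andP; split.
  by apply/negP => /allpairsP [p []].
by apply: allpairs_uniq => // -[a b] [c d] _ _ /= [-> ->].
Qed.

Lemma mem_ptrees n (t : ptree) : (t \in ptrees n) = (order t <= n)%N.
Proof.
rewrite mem_pmap_sub /= mem_filter andb_idr //.
exact: mem_trees_height.
Qed.

Lemma uniq_ptrees n : uniq (ptrees n).
Proof. exact/pmap_sub_uniq/filter_uniq/uniq_trees_height. Qed.

Lemma order_over s t : order (over s t) = (order s + order t)%N.
Proof. by elim: t => [|l IH r _] /=; lia. Qed.

Lemma order_under s t : order (under s t) = (order s + order t)%N.
Proof. by elim: s => [|l _ r IH] /=; lia. Qed.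

Lemma order_ptree_gt0 (t : ptree) : (0 < order t)%N.
Proof. by case: t => -[]. Qed.

(* [S t] is the coefficient of t; two series are equal when S =1 T. *)
Definition series (R : comNzRingType) := ptree -> R.

Section Series.
Variable R : comNzRingType.
Implicit Types (S T : series R) (w : R).

Definition seriesY : series R := fun t => (t == vertex)%:R.

(* Bilinear extensions of over and under.  By order_over and order_under only
   trees of order at most [order u] contribute to the coefficient of u. *)
Definition series_over S T : series R := fun u =>
  \sum_(s <- ptrees (order u))
    \sum_(t <- ptrees (order u) | over s t == u) S s * T t.

Definition series_under S T : series R := fun u =>
  \sum_(s <- ptrees (order u))
    \sum_(t <- ptrees (order u) | under s t == u) S s * T t.

(* The series T^t: T inserted at every internal vertex of t.  The value at Leaf
   is a dummy which is never used. *)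
Fixpoint insertion T (t : tree) : series R :=
  match t with
  | Leaf => fun=> 0
  | Node Leaf Leaf => T
  | Node l Leaf => series_over (insertion T l) T
  | Node Leaf r => series_under T (insertion T r)
  | Node l r =>
      series_under (series_over (insertion T l) T) (insertion T r)
  end.

(* The series T^t starts in order [order t] (insertion_eq0), hence the
   coefficient of u in the sum of all S_t T^t is the finite sum below. *)
Definition series_comp S T : series R := fun u =>
  \sum_(t <- ptrees (order u)) S t * insertion T t u.

Definition Gdif S : Prop := S vertex = 1.

Definition Gdif_inverse S T : Prop :=
  [/\ Gdif S, Gdif T, series_comp S T =1 seriesY & series_comp T S =1 seriesY].

End Series.

Arguments seriesY {R}.

Declare Scope series_scope.
Delimit Scope series_scope with series.
Notation "S \over T" := (series_over S T)
  (at level 40, left associativity) : series_scope.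
Notation "S \under T" := (series_under S T)
  (at level 40, left associativity) : series_scope.

(* Coefficientwise specialization of the parameter 'X at z. *)
Definition specialize (R : comNzRingType) (z : R) (S : series {poly R}) :
  series R := fun t => (S t).[z].

Section Facts.
Variable R : comNzRingType.
Implicit Types (S T : series R) (w : R).
Local Open Scope series_scope.

Lemma series_over_eq0 S T m n (u : ptree) :
    (forall t : ptree, (order t < m)%N -> S t = 0) ->
    (forall t : ptree, (order t < n)%N -> T t = 0) ->
  (order u < m + n)%N -> (S \over T) u = 0.
Proof.
move=> S0 T0 ltu; rewrite /series_over; apply: big1 => s _.
apply: big1 => t /eqP eu; move: ltu; rewrite -eu order_over => ltu.
have [lt_s|le_s] := ltnP (order s) m; first by rewrite S0 ?mul0r.
by rewrite T0 ?mulr0 //; lia.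
Qed.

Lemma series_under_eq0 S T m n (u : ptree) :
    (forall t : ptree, (order t < m)%N -> S t = 0) ->
    (forall t : ptree, (order t < n)%N -> T t = 0) ->
  (order u < m + n)%N -> (S \under T) u = 0.
Proof.
move=> S0 T0 ltu; rewrite /series_under; apply: big1 => s _.
apply: big1 => t /eqP eu; move: ltu; rewrite -eu order_under => ltu.
have [lt_s|le_s] := ltnP (order s) m; first by rewrite S0 ?mul0r.
by rewrite T0 ?mulr0 //; lia.
Qed.

Lemma insertion_eq0 T (t : tree) (u : ptree) :
  (order u < order t)%N -> insertion T t u = 0.
Proof.
have T0 (v : ptree) : (order v < 1)%N -> T v = 0.
  by have := order_ptree_gt0 v; lia.
elim: t u => [|l IHl r IHr] u //; case: l IHl => [|l1 l2] IHl.
  case: r IHr => [|r1 r2] IHr ltu; first exact: T0.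
  exact: (series_under_eq0 T0 IHr).
case: r IHr => [|r1 r2] IHr ltu.
  by apply: (series_over_eq0 IHl T0); move: ltu => /=; lia.
apply: (series_under_eq0 (m := (order (Node l1 l2)).+1) _ IHr) => [v ltv|].
  by apply: (series_over_eq0 IHl T0); lia.
by move: ltu => /=; lia.
Qed.

(* Well-posedness of definitions of series by induction on the order: F S
   only depends in order n on the part of S of order < n. *)
Definition contracting (F : series R -> series R) : Prop :=
  forall S T (u : ptree),
    (forall t : ptree, (order t < order u)%N -> S t = T t) -> F S u = F T u.

Lemma contracting_fixpoint (F : series R -> series R) : contracting F ->
  (exists S, S =1 F S) /\ (forall S T, S =1 F S -> T =1 F T -> S =1 T).
Proof.
move=> cF; have stable n m (t : ptree) : (order t <= n)%N -> (order t <= m)%N ->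
    iter n F (fun=> 0) t = iter m F (fun=> 0) t.
  elim: n m t => [|n IH] [|m] t; try by have := order_ptree_gt0 t; lia.
  by move=> tn tm /=; apply: cF => v ltv; apply: IH; lia.
split.
  exists (fun t : ptree => iter (order t) F (fun=> 0) t) => u.
  have /prednK <- := order_ptree_gt0 u; apply: cF => t ltu.
  by apply: stable; lia.
move=> S T eS eT u; have [n] := ubnP (order u); elim: n u => // n IH u ltn.
by rewrite eS eT; apply: cF => t ltu; apply: IH; lia.
Qed.

Lemma eq_series_over S S' T T' (u : ptree) :
    (forall t : ptree, (order t < order u)%N -> S t = S' t) ->
    (forall t : ptree, (order t < order u)%N -> T t = T' t) ->
  (S \over T) u = (S' \over T') u.
Proof.
move=> eS eT; apply: eq_bigr => s _; apply: eq_bigr => t /eqP eu.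
have := (order_ptree_gt0 s, order_ptree_gt0 t) => -[s0 t0].
by rewrite eS ?eT // -eu order_over; lia.
Qed.

Lemma eq_series_under S S' T T' (u : ptree) :
    (forall t : ptree, (order t < order u)%N -> S t = S' t) ->
    (forall t : ptree, (order t < order u)%N -> T t = T' t) ->
  (S \under T) u = (S' \under T') u.
Proof.
move=> eS eT; apply: eq_bigr => s _; apply: eq_bigr => t /eqP eu.
have := (order_ptree_gt0 s, order_ptree_gt0 t) => -[s0 t0].
by rewrite eS ?eT // -eu order_under; lia.
Qed.

Lemma seriesA_wf w : contracting (fun A =>
  seriesY \+ (w \*o (A \over seriesY)) \+ (seriesY \under A)
    \+ (w \*o (A \over seriesY \under A))).
Proof.
move=> S T u eST /=; congr (_ + w * _ + _ + w * _).
- exact: eq_series_over.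
- exact: eq_series_under.
apply: eq_series_under => // t ltu; apply: eq_series_over => // v ltv.
by apply: eST; lia.
Qed.

Lemma seriesB_wf w : contracting (fun B =>
  seriesY \- (w \*o (seriesY \over B)) \- (B \under seriesY)
    \- (w \*o (seriesY \over B \under seriesY))).
Proof.
move=> S T u eST /=; congr (_ - w * _ - _ - w * _).
- exact: eq_series_over.
- exact: eq_series_under.
apply: eq_series_under => // t ltu; apply: eq_series_over => // v ltv.
by apply: eST; lia.
Qed.

End Facts.

(* Main.v *)
Require Import Defs.
From mathcomp Require Import all_boot all_order all_algebra.
From mathcomp Require Import boolp reals complex.
From mathcomp Require Import zify ring.
(* Makes [order] the order of a tree again, rather than that of an orbit. *)
Import Defs.

(** Right composition [S |-> S o B] is linear, sends Y to B, and respects both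
products: inserting B at the vertices of [s / t] is the same as inserting it in
s and in t and taking the over product of the results, and likewise for
[s \ t] ([comp_over], [comp_under]).  Hence composing the equation of A with B
shows that [C := A o B] solves
  [C = B + w C/B + B\C + w C/B\C].
This equation determines C by induction on the order, because B has no term of
order 0 ([eqnA_contracting]).  But Y is also a solution: moving the negative terms of
  [B = Y - w Y/B - B\Y - w Y/B\Y]
to the other side yields [Y = B + w Y/B + B\Y + w Y/B\Y].  So [A o B = Y].  The
argument is symmetric: [D := B o A] solves [D = A - w A/D - D\A - w A/D\A], and
the equation of A says that Y does too.

All of this holds over an arbitrary commutative ring, for an arbitrary w.
Evaluation of polynomials at z is a ring morphism, so the specialized series
satisfy the same two equations with [w := z], and the general result applies to
them as well. *)

Set Implicit Arguments.
Unset Strict Implicit.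
Unset Printing Implicit Defensive.

Import GRing.Theory.
Local Open Scope ring_scope.
Local Open Scope series_scope.

(** * Sums over trees of bounded order *)

Section TreeSums.
Variable R : comNzRingType.

Lemma sum_ptrees_widen (m n : nat) (F : ptree -> R) : (m <= n)%N ->
    (forall t : ptree, (m < order t)%N -> F t = 0) ->
  \sum_(t <- ptrees m) F t = \sum_(t <- ptrees n) F t.
Proof.
move=> le_mn F0.
have eq_m : perm_eq (ptrees m) [seq t : ptree <- ptrees n | (order t <= m)%N].
  apply: uniq_perm; rewrite ?filter_uniq ?uniq_ptrees // => t.
  by rewrite mem_filter !mem_ptrees; apply/idP/andP => [|[]//]; lia.
rewrite (perm_big _ eq_m) big_filter big_mkcond /=; apply: eq_bigr => t _.
by case: leqP => // /F0.
Qed.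

(** The summand is a function of all trees, so that x can be an expression
such as [over s t] that is not given as an element of [ptree]. *)
Lemma sum_ptrees_delta (n : nat) (x : tree) (F : tree -> R) :
    x != Leaf -> ((n < order x)%N -> F x = 0) ->
  \sum_(t <- ptrees n) (x == t)%:R * F t = F x.
Proof.
move=> x0 Fx0; have [le_xn|/Fx0 Fx] := leqP (order x) n; last first.
  rewrite Fx; apply: big1 => t _.
  by case: eqP => [<-|_]; rewrite ?Fx ?mulr0 ?mul0r.
have Px : PTree x0 \in ptrees n by rewrite mem_ptrees.
rewrite (bigD1_seq _ Px (uniq_ptrees n)) /= eqxx mul1r big1 ?addr0 // => t.
by rewrite eq_sym -val_eqE /= => /negbTE->; rewrite mul0r.
Qed.

End TreeSums.

(** * Bilinear extensions of graded products of trees *)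

Section GradedProduct.
Variable R : comNzRingType.
Implicit Types S T U : series R.

(** The common form of [series_over] and [series_under], to which both are
convertible. *)
Definition series_prod (op : tree -> tree -> tree) S T : series R := fun u =>
  \sum_(s <- ptrees (order u))
    \sum_(t <- ptrees (order u) | op s t == u) S s * T t.

Definition graded (op : tree -> tree -> tree) : Prop :=
  forall s t, order (op s t) = (order s + order t)%N.

Lemma graded_neq_Leaf op : graded op -> forall s t : ptree, op s t != Leaf.
Proof.
move=> gop s t; apply/eqP => e; have := gop s t.
by rewrite e /=; have := order_ptree_gt0 s; lia.
Qed.

(** Any sufficiently large common bound n may replace the bound [order u], and
the condition becomes a factor; nested sums can then be interchanged freely. *)
Lemma series_prodE op n S T (u : ptree) : graded op -> (order u <= n)%N ->
  series_prod op S T u =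
    \sum_(s <- ptrees n) \sum_(t <- ptrees n) (op s t == u)%:R * (S s * T t).
Proof.
move=> gop le_un; have opF (s t : tree) :
    (order u < order s + order t)%N -> (op s t == u) = false.
  by move=> lt; apply/eqP => e; move: lt; rewrite -e gop; lia.
rewrite /series_prod -(@sum_ptrees_widen _ _ n _ le_un); last first.
  by move=> s lts; apply: big1 => t _; rewrite opF ?mul0r //; lia.
apply: eq_bigr => s _; rewrite -(@sum_ptrees_widen _ _ n _ le_un); last first.
  by move=> t ltt; rewrite opF ?mul0r //; lia.
rewrite big_mkcond; apply: eq_bigr => t _.
by case: (_ == _); rewrite ?mul1r ?mul0r.
Qed.

(** Two products are allowed so as to cover the associativity of over, that of
under, and the relation [(a/b)\c = a/(b\c)] at once. *)
Lemma series_prodA op1 op2 S T U : graded op1 -> graded op2 ->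
    (forall s t v : ptree, op2 (op1 s t) v = op1 s (op2 t v)) ->
  series_prod op2 (series_prod op1 S T) U =
  series_prod op1 S (series_prod op2 T U).
Proof.
move=> g1 g2 opA; apply: funext => u; set n := order u.
pose mid := \sum_(s <- ptrees n) \sum_(t <- ptrees n) \sum_(v <- ptrees n)
  (op2 (op1 s t) v == u)%:R * (S s * T t * U v).
transitivity mid.
  transitivity (\sum_(v <- ptrees n) \sum_(s <- ptrees n) \sum_(t <- ptrees n)
      \sum_(r <- ptrees n) (op1 s t == r)%:R *
        ((op2 r v == u)%:R * (S s * T t * U v))).
    rewrite (series_prodE _ _ g2 (leqnn n)) exchange_big; apply: eq_bigr => v _.
    transitivity (\sum_(r <- ptrees n) \sum_(s <- ptrees n)
        \sum_(t <- ptrees n) (op1 s t == r)%:R *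
          ((op2 r v == u)%:R * (S s * T t * U v))).
      apply: eq_big_seq => r; rewrite mem_ptrees => le_rn.
      rewrite (series_prodE _ _ g1 le_rn) mulr_suml mulr_sumr.
      apply: eq_bigr => s _; rewrite mulr_suml mulr_sumr.
      by apply: eq_bigr => t _; ring.
    by rewrite exchange_big; apply: eq_bigr => s _; rewrite exchange_big.
  rewrite exchange_big; apply: eq_bigr => s _; rewrite exchange_big.
  apply: eq_bigr => t _; apply: eq_bigr => v _.
  apply: (sum_ptrees_delta (F := fun x => (op2 x v == u)%:R * _)).
    exact: graded_neq_Leaf.
  move=> lt; rewrite (_ : (_ == _) = false) ?mul0r //.
  by apply/eqP => e; move: lt; rewrite /n -e g2; lia.
symmetry; rewrite (series_prodE _ _ g1 (leqnn n)); apply: eq_bigr => s _.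
transitivity (\sum_(r <- ptrees n) \sum_(t <- ptrees n) \sum_(v <- ptrees n)
    (op2 t v == r)%:R * ((op1 s r == u)%:R * (S s * T t * U v))).
  apply: eq_big_seq => r; rewrite mem_ptrees => le_rn.
  rewrite (series_prodE _ _ g2 le_rn) !mulr_sumr.
  apply: eq_bigr => t _; rewrite !mulr_sumr.
  by apply: eq_bigr => v _; ring.
rewrite exchange_big; apply: eq_bigr => t _; rewrite exchange_big.
apply: eq_bigr => v _; rewrite opA.
apply: (sum_ptrees_delta (F := fun x => (op1 s x == u)%:R * _)).
  exact: graded_neq_Leaf.
move=> lt; rewrite (_ : (_ == _) = false) ?mul0r //.
by apply/eqP => e; move: lt; rewrite /n -e g1; lia.
Qed.

End GradedProduct.

(** * Over and under products of trees and of series *)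

Lemma overA s t u : over (over s t) u = over s (over t u).
Proof. by elim: u => //= l -> r. Qed.

Lemma underA s t u : under (under s t) u = under s (under t u).
Proof. by elim: s => //= l _ r ->. Qed.

(** For [t = Leaf] the left side grafts u on the right-most leaf of s and the
right side grafts s on the left-most leaf of u. *)
Lemma over_under s t u : t != Leaf -> under (over s t) u = over s (under t u).
Proof. by case: t. Qed.

Section SeriesProducts.
Variable R : comNzRingType.
Implicit Types S T U : series R.

Lemma series_overA S T U : S \over T \over U = S \over (T \over U).
Proof.
by apply: series_prodA => *; [exact: order_over | exact: order_over | exact: overA].
Qed.

Lemma series_underA S T U : S \under T \under U = S \under (T \under U).
Proof.
by apply: series_prodA => *; [exact: order_under | exact: order_under | exact: underA].
Qed.

Lemma series_over_under S T U : S \over T \under U = S \over (T \under U).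
Proof.
apply: series_prodA; [exact: order_over | exact: order_under |].
by move=> s t v; apply: over_under; case: t.
Qed.

(** * Right composition is a morphism for both products *)

Lemma insertion_over T s t : s != Leaf -> t != Leaf ->
  insertion T (over s t) = insertion T s \over insertion T t.
Proof.
move=> s0; elim: t => // l IHl r _ _.
have os : over s l != Leaf by case: (l) => //; case: (s) s0.
have ins_os : insertion T (over s l) = if l is Leaf then insertion T s
    else insertion T s \over insertion T l by case: (l) IHl => // ? ? ->.
move: os ins_os; rewrite /=; case: (over s l) => // a b _ ->.
case: l {IHl} => [|l1 l2]; case: r => [|r1 r2] //.
- exact: series_over_under.
- exact: series_overA.
by rewrite series_overA series_over_under.
Qed.

Lemma insertion_under T s t : s != Leaf -> t != Leaf ->
  insertion T (under s t) = insertion T s \under insertion T t.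
Proof.
move=> + t0; elim: s => // l _ r IHr _.
have ut : under r t != Leaf by case: (r) => //; case: (t) t0.
have ins_ut : insertion T (under r t) = if r is Leaf then insertion T t
    else insertion T r \under insertion T t by case: (r) IHr => // ? ? ->.
move: ut ins_ut; rewrite /=; case: (under r t) => // a b _ ->.
case: r {IHr} => [|r1 r2]; case: l => [|l1 l2] //.
  by rewrite series_underA.
by rewrite series_underA.
Qed.

(** Both sides are the sum of [S s * S' s' * T^(op s s')] over all s and s'. *)
Lemma comp_prod op S S' T : graded op ->
    (forall s s' : ptree, insertion T (op s s') =
      series_prod op (insertion T s) (insertion T s')) ->
  series_comp (series_prod op S S') T =
  series_prod op (series_comp S T) (series_comp S' T).
Proof.
move=> gop insop; apply: funext => u; set n := order u.
transitivity (\sum_(s <- ptrees n) \sum_(s' <- ptrees n)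
    S s * S' s' * insertion T (op s s') u).
  transitivity (\sum_(t <- ptrees n) \sum_(s <- ptrees n) \sum_(s' <- ptrees n)
      (op s s' == t)%:R * (S s * S' s' * insertion T t u)).
    apply: eq_big_seq => t; rewrite mem_ptrees => le_tn.
    rewrite (series_prodE _ _ gop le_tn) mulr_suml; apply: eq_bigr => s _.
    by rewrite mulr_suml; apply: eq_bigr => s' _; ring.
  rewrite exchange_big; apply: eq_bigr => s _; rewrite exchange_big.
  apply: eq_bigr => s' _.
  apply: (sum_ptrees_delta (F := fun x => S s * S' s' * insertion T x u)).
    exact: graded_neq_Leaf.
  by move=> lt; rewrite insertion_eq0 ?mulr0.
have compE (P : series R) (a : ptree) : a \in ptrees n ->
    series_comp P T a = \sum_(s <- ptrees n) P s * insertion T s a.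
  rewrite mem_ptrees => le_an; apply: sum_ptrees_widen => // s lt_as.
  by rewrite insertion_eq0 ?mulr0.
symmetry; rewrite (series_prodE _ _ gop (leqnn n)).
transitivity (\sum_(a <- ptrees n) \sum_(b <- ptrees n) \sum_(s <- ptrees n)
    \sum_(s' <- ptrees n) S s * S' s' *
      ((op a b == u)%:R * (insertion T s a * insertion T s' b))).
  apply: eq_big_seq => a Pa; apply: eq_big_seq => b Pb.
  rewrite (compE S a Pa) (compE S' b Pb) mulr_suml mulr_sumr.
  apply: eq_bigr => s _; rewrite !mulr_sumr.
  by apply: eq_bigr => s' _; ring.
under eq_bigr => a _ do rewrite exchange_big.
rewrite exchange_big; apply: eq_bigr => s _ /=.
under eq_bigr => a _ do rewrite exchange_big.
rewrite exchange_big; apply: eq_bigr => s' _ /=.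
rewrite insop (series_prodE _ _ gop (leqnn n)) mulr_sumr.
by apply: eq_bigr => a _; rewrite mulr_sumr.
Qed.

Lemma comp_over S S' T :
  series_comp (S \over S') T = series_comp S T \over series_comp S' T.
Proof.
apply: comp_prod; first exact: order_over.
by move=> [s s0] [t t0]; apply: insertion_over.
Qed.

Lemma comp_under S S' T :
  series_comp (S \under S') T = series_comp S T \under series_comp S' T.
Proof.
apply: comp_prod; first exact: order_under.
by move=> [s s0] [t t0]; apply: insertion_under.
Qed.

Lemma comp_Y T : series_comp seriesY T = T.
Proof.
apply: funext => u; rewrite /series_comp /seriesY.
under eq_bigr => t _ do rewrite eq_sym -val_eqE.
apply: (@sum_ptrees_delta _ _ _ (fun x => insertion T x u)) => //=.
by have := order_ptree_gt0 u; lia.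
Qed.

Lemma comp_add S S' T :
  series_comp (S \+ S') T = series_comp S T \+ series_comp S' T.
Proof.
apply: funext => u; rewrite /series_comp /= -big_split /=.
by apply: eq_bigr => t _; rewrite mulrDl.
Qed.

Lemma comp_sub S S' T :
  series_comp (S \- S') T = series_comp S T \- series_comp S' T.
Proof.
apply: funext => u; rewrite /series_comp /= -sumrB.
by apply: eq_bigr => t _; rewrite mulrBl.
Qed.

Lemma comp_scale w S T : series_comp (w \*o S) T = w \*o series_comp S T.
Proof.
apply: funext => u; rewrite /series_comp /= mulr_sumr.
by apply: eq_bigr => t _; rewrite mulrA.
Qed.

End SeriesProducts.

(** * The two series are mutually inverse over any commutative ring *)

Section Inverse.
Variables (R : comNzRingType) (w : R).
Implicit Types A B T : series R.

(** Composing the equation of A with B replaces Y by B, hence the parameter T;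
both [T = Y] and [T = B] occur below. *)
Definition eqnA T A : series R :=
  T \+ (w \*o (A \over T)) \+ (T \under A) \+ (w \*o (A \over T \under A)).

(** As for [eqnA], here with [T = Y] and [T = A]. *)
Definition eqnB T B : series R :=
  T \- (w \*o (T \over B)) \- (B \under T) \- (w \*o (T \over B \under T)).

Lemma eqnA_contracting T : contracting (eqnA T).
Proof.
move=> S S' u eS; congr (_ + w * _ + _ + w * _).
- exact: eq_series_over.
- exact: eq_series_under.
apply: eq_series_under => // t ltu; apply: eq_series_over => // v ltv.
by apply: eS; lia.
Qed.

Lemma eqnB_contracting T : contracting (eqnB T).
Proof.
move=> S S' u eS; congr (_ - w * _ - _ - w * _).
- exact: eq_series_over.
- exact: eq_series_under.
apply: eq_series_under => // t ltu; apply: eq_series_over => // v ltv.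
by apply: eS; lia.
Qed.

Lemma over_vertex S T : (S \over T) vertex = 0 :> R.
Proof.
by apply: (@series_over_eq0 _ _ _ 1 1) => // t; have := order_ptree_gt0 t; lia.
Qed.

Lemma under_vertex S T : (S \under T) vertex = 0 :> R.
Proof.
by apply: (@series_under_eq0 _ _ _ 1 1) => // t; have := order_ptree_gt0 t; lia.
Qed.

Lemma comp_eqnA T A B :
  series_comp (eqnA T A) B = eqnA (series_comp T B) (series_comp A B).
Proof. by rewrite !(comp_add, comp_scale, comp_under, comp_over). Qed.

Lemma comp_eqnB T B A :
  series_comp (eqnB T B) A = eqnB (series_comp T A) (series_comp B A).
Proof. by rewrite !(comp_sub, comp_scale, comp_under, comp_over). Qed.

(** Exchanging the two arguments of one equation gives the other one, up to
moving the products to the other side. *)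
Lemma eqnA_swap S T : S =1 eqnA T S <-> T =1 eqnB S T.
Proof. by split=> eST u; have := eST u; rewrite /eqnA /eqnB /= => e; ring: e. Qed.

Theorem eqnAB_inverse A B :
  A =1 eqnA seriesY A -> B =1 eqnB seriesY B -> Gdif_inverse A B.
Proof.
move=> defA defB; split.
- rewrite /Gdif defA; transitivity (1 + w * 0 + 0 + w * 0 : R); last by ring.
  by congr (_ + w * _ + _ + w * _); rewrite ?over_vertex ?under_vertex.
- rewrite /Gdif defB; transitivity (1 - w * 0 - 0 - w * 0 : R); last by ring.
  by congr (_ - w * _ - _ - w * _); rewrite ?over_vertex ?under_vertex.
- apply: (proj2 (contracting_fixpoint (eqnA_contracting B))); last exact/eqnA_swap.
  by rewrite -{2}(comp_Y B) -comp_eqnA -(funext defA).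
apply: (proj2 (contracting_fixpoint (eqnB_contracting A))); last exact/eqnA_swap.
by rewrite -{2}(comp_Y A) -comp_eqnB -(funext defB).
Qed.

End Inverse.

(** * Specialization of the parameter *)

Section Specialize.
Variables (R : comNzRingType) (z : R).
Implicit Types S T : series {poly R}.

Lemma specialize_prod op S T : specialize z (series_prod op S T) =
  series_prod op (specialize z S) (specialize z T).
Proof.
apply: funext => u; rewrite /specialize /series_prod horner_sum.
by apply: eq_bigr => s _; rewrite horner_sum; apply: eq_bigr => t _; rewrite hornerM.
Qed.

Lemma specialize_over S T :
  specialize z (S \over T) = specialize z S \over specialize z T.
Proof. exact: specialize_prod. Qed.

Lemma specialize_under S T :
  specialize z (S \under T) = specialize z S \under specialize z T.
Proof. exact: specialize_prod. Qed.

Lemma specializeY : specialize z seriesY = seriesY.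
Proof.
by apply: funext => u; rewrite /specialize /seriesY; case: eqP; rewrite ?hornerC.
Qed.

Lemma specialize_eqnA T A :
  specialize z (eqnA 'X T A) = eqnA z (specialize z T) (specialize z A).
Proof.
rewrite /eqnA -!(specialize_over, specialize_under); apply: funext => u.
by rewrite /specialize /= !hornerE.
Qed.

Lemma specialize_eqnB T B :
  specialize z (eqnB 'X T B) = eqnB z (specialize z T) (specialize z B).
Proof.
rewrite /eqnB -!(specialize_over, specialize_under); apply: funext => u.
by rewrite /specialize /= !hornerE.
Qed.

End Specialize.

Theorem proposition3p1 (R : realType) (A B : series {poly R[i]})
    (defA : A =1 seriesY \+ ('X \*o (A \over seriesY)) \+ (seriesY \under A)
                 \+ ('X \*o (A \over seriesY \under A)))
    (defB : B =1 seriesY \- ('X \*o (seriesY \over B)) \- (B \under seriesY)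
                 \- ('X \*o (seriesY \over B \under seriesY))) :
  Gdif_inverse A B
  /\ (forall z : R[i], Gdif_inverse (specialize z A) (specialize z B)).
Proof.
split; first exact: eqnAB_inverse defA defB.
move=> z; apply: (@eqnAB_inverse _ z).
  by rewrite -(specializeY z) -specialize_eqnA -[eqnA _ _ _](funext defA).
by rewrite -(specializeY z) -specialize_eqnB -[eqnB _ _ _](funext defB).
Qed.
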